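(* Let $\mathcal{H}$ be a separable real Hilbert space, let $T\colon \mathcal{H} \to \ell_2$ be the analysis operator of a frame of $\mathcal{H}$, and let $\mathrm{Prox}\colon \ell_2 \to \ell_2$ be an arbitrary proximity operator. Then $T^{\dagger} \, \mathrm{Prox} \, T$ is itself a proximity operator on $\mathcal{H}$ equipped with the norm $\| \cdot \|_{\mathcal{H}_T}$. In particular, for $\mathrm{Prox} := S_\lambda$ with $\lambda > 0$ it holds for all $x\in\mathcal{H}$ that $$T^{\dagger} \, S_\lambda \, T (x) = \operatorname*{argmin}_{y \in \mathcal{H}} \Bigl\{ \tfrac12\|x-y\|_{\mathcal{H}_T}^2 + f(y)\Bigr\}, \qquad f(y) := \Bigl(\lambda \|\cdot\|_1 \,\square\, \bigl( \tfrac12 \| \cdot \|_{\ell_2}^2 + \iota_{\mathcal{N}(T^* )} \bigr)\Bigr) (Ty),$$ where $\mathcal{N}(T^* )$ denotes the kernel of $T^*$.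
   Context: $\ell_2$ is the real Hilbert space of square summable real sequences $c=\{c_k\}_{k\in\mathbb{N}}$ with norm $\|c\|_{\ell_2} = (\sum_{k} |c_k|^2)^{1/2}$, and $\|c\|_1 = \sum_k |c_k| \in [0,\infty]$ for $c\in\ell_2$. A family $\{x_k\}_{k\in\mathbb{N}}$ in $\mathcal{H}$ is a frame of $\mathcal{H}$ if there exist constants $0<A\le B<\infty$ with $A\|x\|_{\mathcal{H}}^2 \le \sum_{k\in\mathbb{N}} |\langle x,x_k\rangle_{\mathcal{H}}|^2 \le B\|x\|_{\mathcal{H}}^2$ for all $x\in\mathcal{H}$. Its analysis operator is $T\colon\mathcal{H}\to\ell_2$, $Tx = \{\langle x,x_k\rangle_{\mathcal{H}}\}_{k\in\mathbb{N}}$; it is bounded, injective and has closed range. Its Moore-Penrose inverse is $T^\dagger = (T^*T)^{-1}T^*\colon \ell_2\to\mathcal{H}$, with $T^*$ the adjoint with respect to the original inner products. $\mathcal{H}_T$ denotes the linear space $\mathcal{H}$ equipped with the inner product $\langle x,y\rangle_{\mathcal{H}_T} = \langle Tx,Ty\rangle_{\ell_2}$ and norm $\|x\|_{\mathcal{H}_T} = \|Tx\|_{\ell_2}$; this norm is equivalent to $\|\cdot\|_{\mathcal{H}}$, so $\mathcal{H}_T$ is a Hilbert space. For a real Hilbert space $X$, $\Gamma_0(X)$ is the set of proper, convex, lower semi-continuous functions $X\to(-\infty,\infty]$. An operator $X\to X$ is a proximity operator on $X$ if it is of the form $x\mapsto \operatorname{argmin}_{y\in X}\{\frac12\|x-y\|_X^2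 + h(y)\}$ for some $h\in\Gamma_0(X)$. The soft shrinkage operator $S_\lambda\colon\ell_2\to\ell_2$ acts componentwise by $S_\lambda(t) = t-\lambda$ for $t>\lambda$, $S_\lambda(t)=0$ for $t\in[-\lambda,\lambda]$, $S_\lambda(t)=t+\lambda$ for $t<-\lambda$. The infimal convolution is $(f_1\square f_2)(x) = \inf_{y}\{f_1(y)+f_2(x-y)\}$, and the indicator function $\iota_S$ is $0$ on $S$ and $+\infty$ outside $S$. *)

(* Defs.v *)
From HB Require Import structures.
From mathcomp Require Import all_boot all_order all_algebra.
From mathcomp Require Import all_classical all_reals all_analysis.
From mathcomp Require Import ring lra.

Set Implicit Arguments.
Unset Strict Implicit.
Unset Printing Implicit Defensive.

Import Order.TTheory GRing.Theory Num.Theory.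
Import numFieldNormedType.Exports.

Local Open Scope classical_set_scope.
Local Open Scope ring_scope.

HB.mixin Record NormedModule_isInner (R : realType) V & NormedModule R V := {
  inner : V -> V -> R ;
  innerC : forall x y, inner x y = inner y x ;
  innerDl : forall x y z, inner (x + y) z = inner x z + inner y z ;
  innerZl : forall a x y, inner (a *: x) y = a * inner x y ;
  innerxx : forall x, inner x x = `|x| ^+ 2
}.

#[short(type="hilbertType")]
HB.structure Definition Hilbert (R : realType) :=
  {V of CompleteNormedModule R V & NormedModule_isInner R V}.

Section square_summable.
Context {R : realType}.
Implicit Types u v : nat -> R.

Definition square_summable : {pred nat -> R} :=
  fun u => `[< cvgn (series (fun k => u k ^+ 2)) >].

Lemma square_summableP u :
  reflect (cvgn (series (fun k => u k ^+ 2))) (u \in square_summable).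
Proof. exact: asboolP. Qed.

Lemma square_summable_ub u M :
  (forall n, series (fun k => u k ^+ 2) n <= M) -> u \in square_summable.
Proof.
move=> uM; apply/square_summableP/nondecreasing_is_cvgn.
  by apply: nondecreasing_series => n _ _; exact: sqr_ge0.
by exists M => _ [n _ <-].
Qed.

Lemma square_summable_le u v : (forall k, `|u k| <= `|v k|) ->
  v \in square_summable -> u \in square_summable.
Proof.
move=> uv /square_summableP vs; apply/square_summableP.
apply: series_le_cvg vs => [n|n|n]; rewrite ?sqr_ge0//.
by rewrite -(real_normK (num_real (u n))) -(real_normK (num_real (v n))) lerXn2r
  ?nnegrE.
Qed.

Lemma square_summableD u v :
  u \in square_summable -> v \in square_summable -> u + v \in square_summable.
Proof.
move=> /square_summableP us /square_summableP vs; apply/square_summableP.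
have := is_cvg_seriesZ (k := 2) (is_cvg_seriesD us vs).
apply: series_le_cvg => n; rewrite ?sqr_ge0//.
  by apply: mulr_ge0 => //; apply: addr_ge0; exact: sqr_ge0.
rewrite [leRHS](_ : _ = 2 * (u n ^+ 2 + v n ^+ 2))//.
rewrite [leLHS](_ : _ = (u n + v n) ^+ 2)//.
have := sqr_ge0 (u n - v n); rewrite sqrrB sqrrD; lra.
Qed.

Lemma square_summableZ a u : u \in square_summable -> a *: u \in square_summable.
Proof.
move=> /square_summableP us; apply/square_summableP.
rewrite [X in series X](_ : _ = a ^+ 2 *: (fun k => u k ^+ 2)).
  exact: is_cvg_seriesZ.
by apply/funext => k; rewrite /= exprMn.
Qed.

Lemma square_summable_submod_closed : submod_closed square_summable.
Proof.
split=> [|a u v us vs].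
  by apply: (@square_summable_ub _ 0) => n; rewrite /series/= big1// => k _;
    rewrite -[X in X ^+ 2]/(0 : R) expr0n.
by apply: square_summableD => //; exact: square_summableZ.
Qed.

HB.instance Definition _ := GRing.isSubmodClosed.Build R (nat -> R)
  square_summable square_summable_submod_closed.

End square_summable.

Record ell2 (R : realType) := Ell2 {
  ell2_fun :> nat -> R ;
  ell2_square_summable : ell2_fun \in square_summable }.

HB.instance Definition _ (R : realType) := [isSub for @ell2_fun R].
HB.instance Definition _ (R : realType) := [Choice of ell2 R by <:].
HB.instance Definition _ (R : realType) := [SubChoice_isSubLmodule of ell2 R by <:].

Section ell2_theory.
Context {R : realType}.
Implicit Types (u v w : ell2 R) (a : R).

Lemma ell2_cvg_sqr u : cvgn (series (fun k => u k ^+ 2)).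
Proof. exact/square_summableP/ell2_square_summable. Qed.
Arguments ell2_cvg_sqr : clear implicits.

Lemma ell2_addE u v k : (u + v) k = u k + v k.
Proof. by []. Qed.

Lemma ell2_subE u v k : (u - v) k = u k - v k.
Proof. by []. Qed.

Lemma ell2_scaleE a u k : (a *: u) k = a * u k.
Proof. by []. Qed.

Definition ell2_inner u v : R := limn (series (fun k => u k * v k)).

Lemma ell2_cvg_inner u v : cvgn (series (fun k => u k * v k)).
Proof.
apply: normed_cvg.
have := is_cvg_seriesD (ell2_cvg_sqr u) (ell2_cvg_sqr v).
apply: series_le_cvg => n; first exact: normr_ge0.
  by apply: addr_ge0; exact: sqr_ge0.
rewrite [leRHS](_ : _ = u n ^+ 2 + v n ^+ 2)//.
have := sqr_ge0 (u n - v n); have := sqr_ge0 (u n + v n).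
have := sqr_ge0 (u n); have := sqr_ge0 (v n).
rewrite sqrrB sqrrD => ? ? ? ?; rewrite ler_norml; apply/andP; split; lra.
Qed.
Arguments ell2_cvg_inner : clear implicits.

Lemma ell2_innerC u v : ell2_inner u v = ell2_inner v u.
Proof.
by congr (limn (series _)); apply/funext => k; rewrite mulrC.
Qed.

Lemma ell2_innerDl u v w :
  ell2_inner (u + v) w = ell2_inner u w + ell2_inner v w.
Proof.
rewrite -lim_seriesD; [|exact: ell2_cvg_inner..].
by congr (limn (series _)); apply/funext => k; rewrite ell2_addE mulrDl.
Qed.

Lemma ell2_innerZl a u v : ell2_inner (a *: u) v = a * ell2_inner u v.
Proof.
transitivity (a *: ell2_inner u v) => //.
rewrite -lim_seriesZ; last exact: ell2_cvg_inner.
by congr (limn (series _)); apply/funext => k; rewrite ell2_scaleE -mulrA.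
Qed.

Lemma ell2_innerxx u : ell2_inner u u = limn (series (fun k => u k ^+ 2)).
Proof. by []. Qed.

Lemma ell2_sqr_le u n : series (fun k => u k ^+ 2) n <= ell2_inner u u.
Proof.
apply: nondecreasing_cvgn_le; last exact: ell2_cvg_sqr.
by apply: nondecreasing_series => k _ _; exact: sqr_ge0.
Qed.

Lemma ell2_inner_ge0 u : 0 <= ell2_inner u u.
Proof. by apply: le_trans (ell2_sqr_le u 0); rewrite /series/= big_nil. Qed.

Lemma ell2_coord_le u k : u k ^+ 2 <= ell2_inner u u.
Proof.
apply: le_trans (ell2_sqr_le u k.+1).
rewrite /series/= big_nat_recr//= lerDr sumr_ge0// => i _; exact: sqr_ge0.
Qed.

Lemma ell2_inner_eq0 u : ell2_inner u u = 0 -> u = 0.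
Proof.
move=> u0; apply/val_inj/funext => k /=.
have := ell2_coord_le u k; rewrite u0 => uk.
by apply/eqP; rewrite -sqrf_eq0 eq_le uk sqr_ge0.
Qed.

Definition ell2_norm u : R := Num.sqrt (limn (series (fun k => u k ^+ 2))).

Lemma ell2_normE u : ell2_norm u = Num.sqrt (ell2_inner u u).
Proof. by []. Qed.

Lemma sqr_ell2_norm u : ell2_norm u ^+ 2 = ell2_inner u u.
Proof. by rewrite ell2_normE sqr_sqrtr// ell2_inner_ge0. Qed.

Lemma ell2_norm_ge0 u : 0 <= ell2_norm u.
Proof. exact: sqrtr_ge0. Qed.

Lemma ell2_inner_le u v : ell2_inner u v <= ell2_norm u * ell2_norm v.
Proof.
have [/ell2_inner_eq0 ->|v0] := eqVneq (ell2_inner v v) 0.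
  by rewrite ell2_innerC -(scale0r 0) ell2_innerZl mul0r mulr_ge0// ell2_norm_ge0.
have vp : 0 < ell2_inner v v by rewrite lt_neqAle eq_sym v0 ell2_inner_ge0.
set b := ell2_inner v v in v0 vp; set c := ell2_inner u v.
have := ell2_inner_ge0 (b *: u + (- c) *: v).
rewrite !ell2_innerDl !ell2_innerZl.
rewrite ![ell2_inner _ (_ + _)]ell2_innerC !ell2_innerDl !ell2_innerZl.
rewrite (ell2_innerC v u) -/b -/c.
set a := ell2_inner u u => h.
have ca : c ^+ 2 <= a * b.
  rewrite -subr_ge0 -(pmulr_rge0 _ vp).
  rewrite [leRHS](_ : _ = b * (b * a + - c * c) + - c * (b * c + - c * b));
    [exact: h|ring].
have [c0|c0] := leP c 0.
  by apply: le_trans c0 _; rewrite mulr_ge0// ell2_norm_ge0.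
rewrite -(ler_pXn2r (n := 2))// ?nnegrE ?mulr_ge0 ?ell2_norm_ge0 ?(ltW c0)//.
by rewrite exprMn !sqr_ell2_norm.
Qed.

Lemma ell2_normD u v : ell2_norm (u + v) <= ell2_norm u + ell2_norm v.
Proof.
rewrite -(ler_pXn2r (n := 2))// ?nnegrE ?addr_ge0 ?ell2_norm_ge0//.
rewrite sqr_ell2_norm sqrrD !sqr_ell2_norm ell2_innerDl.
rewrite ![ell2_inner _ (_ + _)]ell2_innerC !ell2_innerDl (ell2_innerC v u).
have := ell2_inner_le u v; lra.
Qed.

Lemma ell2_normZ a u : ell2_norm (a *: u) = `|a| * ell2_norm u.
Proof.
rewrite !ell2_normE ell2_innerZl ell2_innerC ell2_innerZl mulrA -expr2.
by rewrite sqrtrM ?sqr_ge0// sqrtr_sqr.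
Qed.

Lemma ell2_norm_eq0 u : ell2_norm u = 0 -> u = 0.
Proof.
by move=> u0; apply: ell2_inner_eq0; rewrite -sqr_ell2_norm u0 expr0n.
Qed.

HB.instance Definition _ := Lmodule_isNormed.Build R (ell2 R)
  ell2_normD ell2_normZ ell2_norm_eq0.

Lemma ell2_coord_norm u k : `|u k| <= `|u|.
Proof.
rewrite -(ler_pXn2r (n := 2))// ?nnegrE// real_normK ?num_real//.
by rewrite [leRHS]sqr_ell2_norm; exact: ell2_coord_le.
Qed.

Lemma ell2_complete (F : set_system (ell2 R)) :
  ProperFilter F -> cauchy F -> cvg F.
Proof.
move=> FF /cauchy_ballP Fc.
pose Fk k := (fun u : ell2 R => u k) @ F.
have Fkc k : cvg (Fk k).
  apply/cauchy_cvgP/cauchy_exP => e e0.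
  have /cauchy_ballP/cauchyP/(_ _ e0)[u Fu] := Fc.
  exists (u k); rewrite /Fk/=; apply: filterS Fu => v.
  rewrite -!ball_normE/=; apply: le_lt_trans.
  exact: (ell2_coord_norm (u - v)).
pose c k : R := lim (Fk k).
have tailF e : 0 < e -> F [set u : ell2 R |
    forall n, series (fun k => (u k - c k) ^+ 2) n <= e ^+ 2].
  move=> e0.
  have : \forall u \near F, \forall v \near F, ball u e v.
    by apply: nearP_dep; exact: Fc.
  apply: filterS => u uF n.
  apply: (@cvgr_to_le _ F _ _ (fun v => series (fun k => (u k - v k) ^+ 2) n)).
    rewrite /series/=; apply: cvg_big => [|k _]; first exact: add_continuous.
    have uc : (u k - v k) @[v --> F] --> u k - c k.
      by apply: cvgB; [exact: cvg_cst|exact: Fkc].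
    exact: (cvgM uc uc).
  apply: filterS uF => v; rewrite -ball_normE/= => /ltW uv.
  apply: le_trans (ell2_sqr_le (u - v) n) _.
  rewrite -sqr_ell2_norm lerXn2r ?nnegrE// ?ell2_norm_ge0// ltW//.
have cs : c \in square_summable.
  near F => u.
  have us : [set u : ell2 R |
      forall n, series (fun k => (u k - c k) ^+ 2) n <= 1 ^+ 2] u.
    by near: u; exact: tailF.
  rewrite -[c](subKr (u : nat -> R)) rpredB ?ell2_square_summable//.
  by apply: (@square_summable_ub _ _ (1 ^+ 2)); apply: us.
apply/cvg_ex; exists (Ell2 cs); apply/cvgrPdist_le => /= e e0.
have := tailF _ e0; apply: filterS => u ue.
rewrite distrC -(ler_pXn2r (n := 2))// ?nnegrE ?(ltW e0)//.
rewrite [leLHS]sqr_ell2_norm; apply: limr_le; first exact: ell2_cvg_inner.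
by apply: nearW => n; exact: ue.
Unshelve. all: by end_near. Qed.

HB.instance Definition _ := Uniform_isComplete.Build (ell2 R) ell2_complete.

HB.instance Definition _ := NormedModule_isInner.Build R (ell2 R)
  ell2_innerC ell2_innerDl ell2_innerZl (fun u => esym (sqr_ell2_norm u)).

End ell2_theory.

Section convex_analysis.
Context {R : realType} {X : hilbertType R}.
Local Open Scope ereal_scope.
Implicit Types f g h : X -> \bar R.

Definition proper_fun h := (forall x, h x != -oo) /\ exists x, h x != +oo.

(* The coefficients [t] and [1 - t] are nonzero and proper functions avoid
   [-oo], so neither [0 * +oo] nor [+oo - oo] occurs below. *)
Definition convex_fun h := forall (x y : X) (t : R), (0 < t < 1)%R ->
  h (t *: x + (1 - t) *: y)%R <= t%:E * h x + (1 - t)%:E * h y.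

Definition Gamma0 : set (X -> \bar R) :=
  [set h | [/\ proper_fun h, convex_fun h & lower_semicontinuous h]].

Definition argmin h : set X := [set p | forall y, h p <= h y].

(* [argmin h = [set p]] says that [p] is the unique minimizer of [h]. *)
Definition is_prox (P : X -> X) := exists2 h, Gamma0 h &
  forall x, argmin (fun y => (2^-1 * `|x - y| ^+ 2)%:E + h y) = [set P x].

Definition inf_convolution f g : X -> \bar R :=
  fun x => ereal_inf (range (fun y => f y + g (x - y)%R)).

Definition indicator (S : set X) : X -> \bar R :=
  fun x => if x \in S then 0 else +oo.

End convex_analysis.

Definition separable (T : topologicalType) :=
  exists2 D : set T, countable D & dense D.

Section operators.
Context {R : realType} {X Y : hilbertType R}.

(* [adjoint] and [moore_penrose] return the default value [0] where the vector
   they describe does not exist. *)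
Definition adjoint (T : X -> Y) : Y -> X :=
  fun c => xget 0 [set y | forall x, inner (T x) c = inner x y].

Definition null_space (T : X -> Y) : set X := [set x | T x = 0].

Definition moore_penrose (T : X -> Y) : Y -> X :=
  'pinv_(fun=> 0) [set: X] (adjoint T \o T) \o adjoint T.

End operators.

Section frames.
Context {R : realType}.

Definition is_frame (H : hilbertType R) (x_ : nat -> H) :=
  exists A B : R, [/\ 0 < A, A <= B & forall x,
    ((A * `|x| ^+ 2)%:E <= \sum_(0 <= k <oo) (inner x (x_ k) ^+ 2)%:E
                        <= (B * `|x| ^+ 2)%:E)%E].

Record frame (H : hilbertType R) := Frame {
  frame_fun :> nat -> H ;
  frameP : is_frame frame_fun }.

Context {H : hilbertType R} (F : frame H).
Implicit Types x y : H.

Lemma analysis_subproof x :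
  (fun k => inner x (F k)) \in (square_summable (R := R)).
Proof.
have [A [B [_ _ /(_ x)/andP[_ xB]]]] := frameP F.
apply: (@square_summable_ub _ _ (B * `|x| ^+ 2)) => n.
rewrite -lee_fin; apply: le_trans xB; rewrite /series/= -sumEFin.
by apply: nneseries_lim_ge => k _ _; rewrite lee_fin sqr_ge0.
Qed.

Definition analysis x : ell2 R := Ell2 (analysis_subproof x).

Lemma analysisD x y : analysis (x + y) = analysis x + analysis y.
Proof. by apply/val_inj/funext => k; exact: innerDl. Qed.

Lemma analysisZ a x : analysis (a *: x) = a *: analysis x.
Proof. by apply/val_inj/funext => k; exact: innerZl. Qed.

Lemma analysisB x y : analysis (x - y) = analysis x - analysis y.
Proof. by rewrite -scaleN1r analysisD analysisZ scaleN1r. Qed.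

Lemma sqr_norm_analysis x : ((`|analysis x| ^+ 2)%:E =
  \sum_(0 <= k <oo) (inner x (F k) ^+ 2)%:E)%E.
Proof.
rewrite [X in (X%:E)%E]sqr_ell2_norm /ell2_inner -EFin_lim.
  by congr (limn _); apply/funext => n; rewrite /= /series/= -sumEFin.
exact: ell2_cvg_inner.
Qed.

Lemma analysis_bounds : exists A B : R, [/\ 0 < A, 0 < B &
  forall x, A * `|x| <= `|analysis x| <= B * `|x|].
Proof.
have [A [B [A0 AB xAB]]] := frameP F.
have B0 := lt_le_trans A0 AB.
exists (Num.sqrt A), (Num.sqrt B); split; rewrite ?sqrtr_gt0// => x.
have := xAB x; rewrite -sqr_norm_analysis !lee_fin.
rewrite -{1}(sqr_sqrtr (ltW A0)) -{1}(sqr_sqrtr (ltW B0)).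
by rewrite -!exprMn !ler_pXn2r// ?nnegrE ?mulr_ge0 ?sqrtr_ge0.
Qed.

Lemma analysis_eq0 x : `|analysis x| = 0 -> x = 0.
Proof.
have [A [B [A0 _ /(_ x)/andP[xA _]]]] := analysis_bounds => x0.
apply/eqP; rewrite -normr_eq0 eq_le normr_ge0 andbT.
by move: xA; rewrite x0 pmulr_rle0.
Qed.

End frames.

(* The space [H] with inner product [<T x, T y>], [T] the analysis operator. *)
Definition HT {R : realType} {H : hilbertType R} (F : frame H) : Type := H.

Section HT_theory.
Context {R : realType} {H : hilbertType R} (F : frame H).

HB.instance Definition _ := GRing.Lmodule.copy (HT F) H.

Definition HT_norm (x : HT F) : R := `|analysis F x|.

Definition HT_inner (x y : HT F) : R := inner (analysis F x) (analysis F y).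

Lemma HT_normD x y : HT_norm (x + y) <= HT_norm x + HT_norm y.
Proof. by rewrite /HT_norm analysisD; exact: ler_normD. Qed.

Lemma HT_normZ a x : HT_norm (a *: x) = `|a| * HT_norm x.
Proof. by rewrite /HT_norm analysisZ normrZ. Qed.

Lemma HT_norm_eq0 x : HT_norm x = 0 -> x = 0.
Proof. exact: analysis_eq0. Qed.

HB.instance Definition _ := Lmodule_isNormed.Build R (HT F)
  HT_normD HT_normZ HT_norm_eq0.

Lemma HT_complete (G : set_system (HT F)) :
  ProperFilter G -> cauchy G -> cvg G.
Proof.
move=> FG /cauchyP Gc.
have [A [B [A0 B0 AB]]] := analysis_bounds F.
pose G' : set_system H := G.
have /cvg_ex[/= l Gl] : cvg G'.
  apply/cauchy_cvgP/cauchy_exP => e e0.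
  have [x Gx] := Gc _ (mulr_gt0 A0 e0).
  exists x; apply: filterS Gx => y; rewrite -!ball_normE/= => xy.
  rewrite -(ltr_pM2l A0); apply: le_lt_trans xy.
  by have /andP[] := AB ((x : H) - y).
apply/cvg_ex; exists (l : HT F); apply/cvgrPdist_lt => /= e e0.
have /cvgrPdist_lt/(_ (e / B))/= := Gl.
rewrite divr_gt0// => /(_ isT); apply: filterS => y ly.
rewrite -[ltLHS]/`|analysis F ((l : H) - y)|.
have /andP[_ /le_lt_trans->//] := AB ((l : H) - y).
by rewrite mulrC -ltr_pdivlMr.
Qed.

HB.instance Definition _ := Uniform_isComplete.Build (HT F) HT_complete.

Lemma HT_innerC x y : HT_inner x y = HT_inner y x.
Proof. exact: innerC. Qed.

Lemma HT_innerDl x y z : HT_inner (x + y) z = HT_inner x z + HT_inner y z.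
Proof. by rewrite /HT_inner analysisD innerDl. Qed.

Lemma HT_innerZl a x y : HT_inner (a *: x) y = a * HT_inner x y.
Proof. by rewrite /HT_inner analysisZ innerZl. Qed.

Lemma HT_innerxx x : HT_inner x x = `|x| ^+ 2.
Proof. exact: innerxx. Qed.

HB.instance Definition _ := NormedModule_isInner.Build R (HT F)
  HT_innerC HT_innerDl HT_innerZl HT_innerxx.

End HT_theory.

Section soft_shrinkage.
Context {R : realType}.

Definition soft (lambda t : R) : R :=
  if lambda < t then t - lambda
  else if t < - lambda then t + lambda else 0.

Lemma soft_le lambda t : 0 < lambda -> `|soft lambda t| <= `|t|.
Proof.
move=> l0; rewrite /soft; case: ifPn => [lt|_].
  by rewrite !ger0_norm; lra.
case: ifPn => [tl|_]; last by rewrite normr0.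
by rewrite !ler0_norm; lra.
Qed.

Lemma soft_square_summable lambda (c : ell2 R) : 0 < lambda ->
  (fun k => soft lambda (c k)) \in (square_summable (R := R)).
Proof.
move=> l0; apply: square_summable_le (ell2_square_summable c) => k.
exact: soft_le.
Qed.

Definition soft_shrinkage lambda (lambda_gt0 : 0 < lambda) (c : ell2 R) :
  ell2 R := Ell2 (soft_square_summable c lambda_gt0).

Definition norm1 (c : ell2 R) : \bar R := (\sum_(0 <= k <oo) `|c k|%:E)%E.

End soft_shrinkage.

(* Main.v *)
Require Import Defs.
From mathcomp Require Import all_boot all_order all_algebra.
From mathcomp Require Import all_classical all_reals all_analysis.
From mathcomp Require Import ring lra.

Import Order.TTheory GRing.Theory Num.Theory.
Import numFieldNormedType.Exports.

Local Open Scope classical_set_scope.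
Local Open Scope ring_scope.

Set Implicit Arguments.
Unset Strict Implicit.
Unset Printing Implicit Defensive.

(** Write [K] for the space [HT F].  With respect to the inner product of [K]
    the analysis operator [T : K -> ell2 R] is an isometry, and its
    Moore-Penrose inverse [L] is its adjoint: [<T x, c> = <x, L c>_K]
    ([moore_penrose_analysisE]).  That [T^*] and the inverse of [T^* T] exist
    at all is the Riesz representation theorem, used once in [H] and once in
    [K].  Everything else is a fact about an isometry [T] and its adjoint [L];
    then [T L] is the orthogonal projection onto the range of [T], whence
    [|T x - c|^2 = |x - L c|^2 + |T (L c) - c|^2] ([isometry_pythagoras]).

    First part.  Proximity operators are characterised without any function:
    [P] is one if and only if some real-valued [r] satisfies
    [r x + <x - P x, P y - P x> <= r y] for all [x], [y].  If [P] is the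
    proximity operator of [h], then [r x := h (P x)] works by the first-order
    optimality condition ([prox_variational]).  Conversely [P] is the proximity
    operator of the supremum of the affine functions
    [y |-> r x + <x - P x, y - P x>], which is convex and lower semicontinuous
    for free ([is_prox_variational]).  If [r] serves for [P], then
    [r (T x) + |c - T (L c)|^2 / 2] with [c := P (T x)] serves for [L P T]
    ([is_prox_compression]).

    Second part.  For a function [g] with subgradient [T x - s] at [s], Pythagoras
    turns the objective at [y] into the infimum of [g c + |T x - c|^2 / 2] over
    the [c] with [L c = y].  The minimum over all [c] is attained at [c = s]
    alone and the objective grows quadratically around it, so the minimizer in
    [y] is [L s] ([argmin_inf_convolution]).  For [g] equal to [lambda] times
    the 1-norm and [s] the soft shrinkage of [d := T x], the residual [d - s] is
    bounded by [lambda] in each coordinate and [<d - s, s> = lambda * |s|_1];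
    together these say that [d - s] is a subgradient of [g] at [s]. *)

(** * Inner product identities *)

Section inner_product.
Context {R : realType} {X : hilbertType R}.
Implicit Types (x y z : X) (a : R).

Lemma innerDr x y z : inner x (y + z) = inner x y + inner x z.
Proof. by rewrite innerC innerDl (innerC y) (innerC z). Qed.

Lemma innerZr a x y : inner x (a *: y) = a * inner x y.
Proof. by rewrite innerC innerZl innerC. Qed.

Lemma innerNl x y : inner (- x) y = - inner x y.
Proof. by rewrite -scaleN1r innerZl mulN1r. Qed.

Lemma innerNr x y : inner x (- y) = - inner x y.
Proof. by rewrite innerC innerNl innerC. Qed.

Lemma innerBl x y z : inner (x - y) z = inner x z - inner y z.
Proof. by rewrite innerDl innerNl. Qed.

Lemma innerBr x y z : inner x (y - z) = inner x y - inner x z.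
Proof. by rewrite innerDr innerNr. Qed.

Lemma sqr_normD x y : `|x + y| ^+ 2 = `|x| ^+ 2 + 2 * inner x y + `|y| ^+ 2.
Proof. by rewrite -!innerxx innerDl !innerDr (innerC y x); ring. Qed.

Lemma sqr_normB x y : `|x - y| ^+ 2 = `|x| ^+ 2 - 2 * inner x y + `|y| ^+ 2.
Proof. by rewrite sqr_normD innerNr normrN mulrN. Qed.

Lemma inner0r x : inner x 0 = 0.
Proof. by rewrite -(subrr x) innerBr subrr. Qed.

Lemma inner_ext x y : (forall z, inner z x = inner z y) -> x = y.
Proof.
move=> xy; apply/eqP; rewrite -subr_eq0 -normr_eq0 -sqrf_eq0 -innerxx.
by rewrite innerBr xy subrr.
Qed.

Lemma cauchy_schwarz x y : `|inner x y| <= `|x| * `|y|.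
Proof.
have inner_le (u v : X) : inner u v <= `|u| * `|v|.
  have [->|v0] := eqVneq v 0.
    by rewrite inner0r normr0 mulr0.
  have [->|u0] := eqVneq u 0.
    by rewrite (innerC 0) inner0r normr0 mul0r.
  have := sqr_ge0 (`| `|v| *: u - `|u| *: v|).
  rewrite sqr_normB !normrZ !normr_id innerZl innerZr => h.
  have p : 0 < `|u| * `|v| by rewrite mulr_gt0 ?normr_gt0.
  rewrite -(ler_pM2l p); lra.
by rewrite ler_norml inner_le andbT lerNl -innerNl -(normrN x) inner_le.
Qed.

End inner_product.

(** * Riesz representation *)

Section riesz.
Context {R : realType} {X : hilbertType R}.

(** The representing vector is the minimizer of [J x := |x|^2 / 2 - phi x]: by
    the parallelogram identity minimizing sequences of [J] are Cauchy, and at a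
    minimizer the derivative [<x, u> - phi x] of [J] vanishes. *)
Theorem riesz_representation (phi : X -> R) (C : R) : 0 <= C ->
    (forall a x y, phi (a *: x + y) = a * phi x + phi y) ->
    (forall x, `|phi x| <= C * `|x|) ->
  exists u, forall x, phi x = inner x u.
Proof.
move=> C0 philin phiC.
have phi0 : phi 0 = 0.
  by have := philin 1 0 0; rewrite scaler0 addr0 mul1r; lra.
have phiD x y : phi (x + y) = phi x + phi y.
  by have := philin 1 x y; rewrite scale1r mul1r.
have phiZ a x : phi (a *: x) = a * phi x.
  by have := philin a x 0; rewrite phi0 !addr0.
pose J x := 2^-1 * `|x| ^+ 2 - phi x.
have Jlb x : - (2^-1 * C ^+ 2) <= J x.
  have := phiC x; rewrite ler_norml => /andP[_]; rewrite /J.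
  have := sqr_ge0 (`|x| - C); rewrite sqrrB; lra.
have Jinf : has_inf (range J).
  by split; [exists (J 0), 0|exists (- (2^-1 * C ^+ 2)) => _ [x _ <-]].
pose m := inf (range J).
have mJ x : m <= J x by apply: ge_inf; [case: Jinf|exists x].
have [u_ uJ] : {u_ : nat -> X & forall n, J (u_ n) < m + n.+1%:R^-1}.
  apply: (@choice _ _ (fun n u => J u < m + n.+1%:R^-1)) => n.
  have [|_ [u _ <-] uJ] := inf_adherent (eps := n.+1%:R^-1) _ Jinf.
    by rewrite invr_gt0.
  by exists u.
have Jmid x y : 8^-1 * `|x - y| ^+ 2 <= 2^-1 * (J x - m) + 2^-1 * (J y - m).
  have := mJ (2^-1 *: (x + y)); rewrite /J phiZ phiD normrZ exprMn.
  rewrite ger0_norm// sqr_normD sqr_normB; lra.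
have u_cvg : cvgn u_.
  apply/cauchy_cvgP/cauchy_exP => /= e e0.
  near \oo => N; exists (u_ N).
  change (\forall n \near \oo, ball (u_ N) e (u_ n)); near=> n.
  rewrite -ball_normE /= -(ltr_pXn2r (n := 2)) ?nnegrE ?(ltW e0)//.
  have := Jmid (u_ N) (u_ n); have := uJ N; have := uJ n.
  have : n.+1%:R^-1 < 8^-1 * e ^+ 2.
    by near: n; apply: near_infty_natSinv_lt (PosNum _); rewrite mulr_gt0 ?exprn_gt0.
  have : N.+1%:R^-1 < 8^-1 * e ^+ 2.
    by near: N; apply: near_infty_natSinv_lt (PosNum _); rewrite mulr_gt0 ?exprn_gt0.
  move: (J (u_ n)) (J (u_ N)) (n.+1%:R^-1) (N.+1%:R^-1) (`|_| ^+ 2) (e ^+ 2) => a b s t v w; lra.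
pose u := limn u_.
have Ju : J u <= m.
  have phi_u : phi (u_ n) @[n --> \oo] --> phi u.
    apply/cvgrPdist_le => /= e e0.
    have /cvgrPdist_le/(_ (e / (C + 1))) := u_cvg.
    rewrite divr_gt0 ?ltr_wpDl// => /(_ isT); apply: filterS => n.
    rewrite ler_pdivlMr ?ltr_wpDl// => un.
    have -> : phi u - phi (u_ n) = phi (u - u_ n).
      by have := phiD (u - u_ n) (u_ n); rewrite subrK => ->; rewrite addrK.
    apply: le_trans (phiC _) _; apply: le_trans un.
    by rewrite mulrC ler_wpM2l// lerDl.
  have J_u : J (u_ n) @[n --> \oo] --> J u.
    apply: cvgB phi_u; apply: cvgMr.
    by rewrite expr2; under eq_cvg do rewrite expr2; apply: cvgM; apply: cvg_norm.
  have Jm_u : J (u_ n) - n.+1%:R^-1 @[n --> \oo] --> J u.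
    by rewrite -[X in _ --> X]subr0; apply: cvgB J_u (cvg_harmonic).
  by apply: cvgr_to_le Jm_u _; apply: nearW => n; rewrite lerBlDr ltW.
exists u => x.
have JuD t : J u <= J (u + t *: x) by apply: le_trans Ju _.
pose d := inner x u - phi x; pose q := `|x| ^+ 2.
have dq t : 0 <= t * d + 2^-1 * t ^+ 2 * q.
  have := JuD t; rewrite /J phiD phiZ sqr_normD innerZr normrZ exprMn.
  rewrite real_normK ?num_real// (innerC u) /d /q; lra.
have q0 : 0 <= q by rewrite sqr_ge0.
suff : d = 0 by rewrite /d; lra.
apply/eqP; rewrite -sqrf_eq0 eq_le sqr_ge0 andbT.
have q1 : 0 < q + 1 by lra.
(* [q + 1] rather than [q] in the denominator because [x] may be zero. *)
have := dq (- d / (q + 1)).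
rewrite -(pmulr_rge0 _ (exprn_gt0 2 q1)).
rewrite [X in 0 <= X](_ : _ = - (d ^+ 2 * (2^-1 * q + 1))); last by field; lra.
rewrite oppr_ge0 pmulr_lle0//; lra.
Unshelve. all: by end_near. Qed.

End riesz.

(** * Variational characterisation of proximity operators *)

Lemma le0_of_quadratic {R : realType} (D q : R) : 0 <= q ->
  (forall t, 0 < t < 1 -> D <= 2^-1 * t * q) -> D <= 0.
Proof.
move=> q0 Dq; rewrite leNgt; apply/negP => D0.
have C0 : 0 < D + q + 1 by lra.
have t01 : 0 < D / (D + q + 1) < 1.
  by rewrite divr_gt0//= ltr_pdivrMr// mul1r; lra.
have := Dq _ t01.
rewrite -(ler_pM2r C0) (_ : _ * q * _ = 2^-1 * D * q); last by field; lra.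
by have := mulr_ge0 (ltW D0) q0; have := mulr_gt0 D0 D0; lra.
Qed.

Section proximity.
Context {R : realType} {X : hilbertType R}.
Implicit Types (x y z p : X) (h : X -> \bar R).

Lemma argmin_quadratic_growth h p (m : R) : (h p <= m%:E)%E ->
    (forall y, ((m + 2^-1 * `|y - p| ^+ 2)%:E <= h y)%E) ->
  argmin h = [set p].
Proof.
move=> hp hy; apply/seteqP; split=> [y /(_ p) yp|_ -> y]; last first.
  apply: le_trans hp _; apply: le_trans (hy y).
  by rewrite lee_fin lerDl mulr_ge0// sqr_ge0.
have := le_trans (hy y) (le_trans yp hp); rewrite lee_fin => yp0.
have yp1 : `|y - p| ^+ 2 <= 0 by lra.
by apply/eqP; rewrite -subr_eq0 -normr_eq0 -sqrf_eq0 eq_le yp1 sqr_ge0.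
Qed.

Lemma prox_fin_num (P : X -> X) h x : Gamma0 h ->
    argmin (fun y => (2^-1 * `|x - y| ^+ 2)%:E + h y)%E = [set P x] ->
  h (P x) \is a fin_num.
Proof.
move=> [[hNy [z hz]] _ _] hP.
have : argmin (fun y => (2^-1 * `|x - y| ^+ 2)%:E + h y)%E (P x) by rewrite hP.
move=> /(_ z) Pz; rewrite fin_numE hNy /=.
apply: contraTneq Pz => ->; rewrite addey// -ltNge.
have /fineK <- : h z \is a fin_num by rewrite fin_numE hNy.
by rewrite ltry.
Qed.

(** First-order optimality: compare [P x] with the points of the segment
    from [P x] to [P y] and let them tend to [P x]. *)
Lemma prox_variational (P : X -> X) h x y : Gamma0 h ->
    (forall x, argmin (fun y => (2^-1 * `|x - y| ^+ 2)%:E + h y)%E = [set P x]) ->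
  fine (h (P x)) + inner (x - P x) (P y - P x) <= fine (h (P y)).
Proof.
move=> h0 hP.
have /fineK := prox_fin_num h0 (hP x); have /fineK := prox_fin_num h0 (hP y).
set a := fine (h (P x)); set b := fine (h (P y)) => hPy hPx.
pose d := P y - P x; pose q := `|d| ^+ 2.
have slope t : 0 < t < 1 -> inner (x - P x) d <= b - a + 2^-1 * t * q.
  move=> t01; have /andP[t0 t1] := t01.
  pose z := t *: P y + (1 - t) *: P x.
  have hz : (h z <= (t * b + (1 - t) * a)%:E)%E.
    by have [_ hcvx _] := h0; have := hcvx (P y) (P x) t t01; rewrite -hPx -hPy.
  have : argmin (fun y => (2^-1 * `|x - y| ^+ 2)%:E + h y)%E (P x) by rewrite hP.
  move=> /(_ z); rewrite -hPx => /le_trans /(_ (leeD2l _ hz)).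
  rewrite -!EFinD lee_fin (_ : x - z = (x - P x) - t *: d); last first.
    rewrite -[RHS]addrA -opprD; congr (x - _).
    by rewrite /z /d scalerBl scale1r scalerBr addrCA.
  rewrite (sqr_normB _ (t *: d)) innerZr normrZ exprMn real_normK ?num_real// -/q => h1.
  by rewrite -(ler_pM2l t0); lra.
have q0 : 0 <= q by rewrite sqr_ge0.
pose D := inner (x - P x) d - (b - a).
suff : D <= 0 by rewrite /D subr_le0 lerBrDl.
apply: (le0_of_quadratic q0) => t t01.
by rewrite /D lerBlDl; exact: slope.
Qed.

(** The function [h] is the smallest one compatible with the inequalities that
    optimality forces at the points [P x]: a supremum of affine functions.  The
    hypothesis says precisely that it takes the value [r x] at [P x], so that
    the affine function indexed by [x] supports it there. *)
Lemma is_prox_variational (P : X -> X) (r : X -> R) :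
    (forall x y, r x + inner (x - P x) (P y - P x) <= r y) -> is_prox P.
Proof.
move=> rP.
pose l x y : R := r x + inner (x - P x) (y - P x).
pose h y := ereal_sup (range (fun x => (l x y)%:E)).
have lh x y : ((l x y)%:E <= h y)%E by apply: ereal_sup_ubound; exists x.
have hP x : h (P x) = (r x)%:E.
  apply/eqP; rewrite eq_le; apply/andP; split.
    by apply: ge_ereal_sup => _ [y _ <-]; rewrite lee_fin; exact: rP.
  by apply: le_trans (lh x _); rewrite /l subrr inner0r addr0.
have hNy y : h y != -oo%E by rewrite -ltNye; apply: lt_le_trans (lh y y); rewrite ltNyr.
have lcvx x y z t : l x (t *: y + (1 - t) *: z) = t * l x y + (1 - t) * l x z.
  rewrite /l !innerBr innerDr !innerZr; ring.
exists h => [|x]; first split.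
- by split=> //; exists (P 0); rewrite hP.
- move=> y z t /andP[t0 t1]; apply: ge_ereal_sup => _ [x _ <-].
  rewrite lcvx EFinD !EFinM; apply: leeD; apply: lee_wpmul2l => //;
    by rewrite lee_fin ?subr_ge0 ltW.
- move=> y a /ereal_sup_gt[_ [x _ <-]]; rewrite lte_fin => aly.
  have e0 : 0 < l x y - a by lra.
  pose C := `|x - P x| + 1; have C0 : 0 < C by rewrite ltr_wpDl.
  (* [l x] is Lipschitz with constant [C], by Cauchy-Schwarz. *)
  exists (ball y ((l x y - a) / C)).
    by apply: nbhsx_ballx; rewrite divr_gt0.
  move=> z; rewrite -ball_normE /= => yz.
  apply: lt_le_trans (lh x z); rewrite lte_fin.
  have := cauchy_schwarz (x - P x) (y - z).
  rewrite ltr_pdivlMr// in yz.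
  have -> : l x z = l x y - inner (x - P x) (y - z).
    by rewrite /l !innerBr; ring.
  rewrite ler_norml => /andP[_]; have := normr_ge0 (y - z).
  by rewrite /C in yz; lra.
- apply: (@argmin_quadratic_growth _ _ (2^-1 * `|x - P x| ^+ 2 + r x)).
    by rewrite hP EFinD.
  move=> y; apply: (@le_trans _ _ ((2^-1 * `|x - y| ^+ 2)%:E + (l x y)%:E)%E).
    have -> : x - y = (x - P x) - (y - P x) by rewrite opprB addrA subrK.
    by rewrite -EFinD lee_fin /l (sqr_normB _ (y - P x)); lra.
  by rewrite leeD2l.
Qed.

End proximity.

(** * Isometries and their adjoints *)

Section isometry.
Context {R : realType} {K Y : hilbertType R} (T : K -> Y) (L : Y -> K).
Hypothesis TB : forall x y, T (x - y) = T x - T y.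
Hypothesis T_isom : forall x y, inner (T x) (T y) = inner x y.
Hypothesis TL_adjoint : forall x c, inner (T x) c = inner x (L c).
Implicit Types (x y : K) (c s : Y).

Lemma adjointB c s : L (c - s) = L c - L s.
Proof. by apply: inner_ext => z; rewrite innerBr -!TL_adjoint innerBr. Qed.

Lemma isometryK x : L (T x) = x.
Proof. by apply: inner_ext => z; rewrite -TL_adjoint T_isom. Qed.

Lemma isometry_norm x : `|T x| ^+ 2 = `|x| ^+ 2.
Proof. by rewrite -!innerxx T_isom. Qed.

Lemma isometry_orthogonal x c : inner (T x) (T (L c) - c) = 0.
Proof. by rewrite innerBr T_isom TL_adjoint subrr. Qed.

Lemma isometry_pythagoras x c :
  `|T x - c| ^+ 2 = `|x - L c| ^+ 2 + `|T (L c) - c| ^+ 2.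
Proof.
have -> : T x - c = T (x - L c) + (T (L c) - c) by rewrite TB addrA subrK.
by rewrite sqr_normD isometry_orthogonal mulr0 addr0 isometry_norm.
Qed.

Lemma adjoint_contraction c : `|L c| ^+ 2 <= `|c| ^+ 2.
Proof.
have := isometry_pythagoras 0 c.
have -> : T 0 = 0 by rewrite -(subrr 0) TB subrr.
by rewrite !sub0r !normrN => ->; rewrite lerDl sqr_ge0.
Qed.

(** With [n x] the component of [P (T x)] (up to sign) orthogonal to the range of
    [T], passing from [P] to [L P T] costs [<n x, n y - n x>] in the variational
    inequality; the term [|n x|^2 / 2] in the new potential pays for it, since
    [|n x|^2 / 2 + <n x, n y - n x> <= |n y|^2 / 2]. *)
Lemma is_prox_compression (P : Y -> Y) : is_prox P -> is_prox (L \o P \o T).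
Proof.
move=> [h h0 hP].
pose n x := T (L (P (T x))) - P (T x).
apply: (@is_prox_variational _ _ _
  (fun x => fine (h (P (T x))) + 2^-1 * `|n x| ^+ 2)) => x y /=.
have := prox_variational (T x) (T y) h0 hP.
set c := P (T x); set c' := P (T y).
have -> : T x - c = T (x - L c) + n x by rewrite TB addrA subrK.
rewrite innerDl TL_adjoint adjointB.
have -> : inner (n x) (c' - c) = `|n x| ^+ 2 - inner (n x) (n y).
  have -> : c' - c = T (L c' - L c) + (n x - n y).
    by rewrite TB /n -/c -/c' opprB addrA subrKA addrC subrKA.
  by rewrite innerDr innerC isometry_orthogonal add0r innerBr innerxx.
have := sqr_ge0 `|n x - n y|; rewrite sqr_normB.
move: (inner (x - L c) _) (fine _) (fine _) => i a b; lra.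
Qed.

(** The indicator restricts the infimal convolution at [T y] to the [c] with
    [L c = y], where the two squared distances add up to [|T x - c|^2 / 2].  As
    [T x - s] is a subgradient of [g] at [s], the total exceeds its value at [s]
    by at least [|c - s|^2 / 2], hence by at least [|y - L s|^2 / 2]. *)
Lemma argmin_inf_convolution (N : set Y) (g : Y -> \bar R) x s (a : R) :
    (forall c, N c <-> L c = 0) -> g s = a%:E ->
    (forall c, ((a + inner (T x - s) (c - s))%:E <= g c)%E) ->
  argmin (fun y => ((2^-1 * `|x - y| ^+ 2)%:E +
    inf_convolution g (fun c => (2^-1 * `|c| ^+ 2)%:E + indicator N c) (T y))%E)
  = [set L s].
Proof.
move=> NP gs gc.
apply: (@argmin_quadratic_growth _ _ _ _ (2^-1 * `|T x - s| ^+ 2 + a)).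
  rewrite isometry_pythagoras mulrDr -addrA EFinD leeD2l//.
  apply: ge_ereal_inf; exists (g s +
      ((2^-1 * `|(T (L s) - s)%R| ^+ 2)%:E + indicator N (T (L s) - s)%R))%E.
    by exists s.
  rewrite /indicator mem_set; last by apply/NP; rewrite adjointB isometryK subrr.
  by rewrite gs adde0 -EFinD lee_fin addrC.
move=> y; set u := inf_convolution _ _ _.
rewrite -[X in X%:E](subrKC (2^-1 * `|x - y| ^+ 2)) EFinD leeD2l//.
apply: le_ereal_inf_tmp => _ [c _ <-]; rewrite /indicator.
case: ifPn => [/set_mem/NP|_]; last first.
  rewrite addey ?leey//.
  by rewrite -ltNye; apply: lt_le_trans (gc c); rewrite ltNyr.
rewrite adjointB isometryK => /eqP; rewrite subr_eq0 => /eqP ->; rewrite adde0.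
apply: le_trans (leeD2r _ (gc c)); rewrite -EFinD lee_fin.
have := isometry_pythagoras x c; have := adjoint_contraction (c - s).
have -> : T x - c = (T x - s) - (c - s) by rewrite opprB addrA subrK.
rewrite adjointB (sqr_normB _ (c - s)).
move: (inner _ _) => i; lra.
Qed.

End isometry.

(** * Soft shrinkage and the 1-norm *)

Section soft_thresholding.
Context {R : realType}.
Implicit Types (c d e : ell2 R).

Lemma inner_le_norm1 (lambda : R) e c : (forall k, `|e k| <= lambda) ->
  ((inner e c)%:E <= lambda%:E * norm1 c)%E.
Proof.
move=> el; have l0 : 0 <= lambda by exact: le_trans (el 0).
rewrite [inner e c]/(ell2_inner e c) -EFin_lim; last exact: ell2_cvg_inner.
apply: lime_le.
  apply/cvg_ex; exists (ell2_inner e c)%:E; apply: cvg_EFin.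
    exact: nearW.
  exact: ell2_cvg_inner.
apply: nearW => n.
apply: (@le_trans _ _ (lambda%:E * \sum_(0 <= k < n) `|c k|%:E))%E.
  rewrite sumEFin -EFinM lee_fin /series /= mulr_sumr ler_sum// => k _.
  by apply: le_trans (ler_norm _) _; rewrite normrM ler_wpM2r.
by apply: lee_wpmul2l; [rewrite lee_fin|exact: nneseries_lim_ge].
Qed.

Lemma soft_residual_le (lambda t : R) : 0 < lambda ->
  `|t - soft lambda t| <= lambda.
Proof.
move=> l0; rewrite /soft ler_norml.
by case: ltP => lt; [|case: ltP => tl]; apply/andP; split; lra.
Qed.

Lemma soft_residualM (lambda t : R) : 0 < lambda ->
  (t - soft lambda t) * soft lambda t = lambda * `|soft lambda t|.
Proof.
move=> l0; rewrite /soft; case: ltP => [lt|_].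
  by rewrite ger0_norm; lra.
case: ltP => [tl|_]; first by rewrite ler0_norm; lra.
by rewrite normr0 !mulr0.
Qed.

(** A coordinate of [s] that does not vanish has the sign of the residual, which
    there has modulus exactly [lambda]; this also shows that the 1-norm of [s] is
    finite. *)
Lemma norm1_soft_shrinkage (lambda : R) (lambda_gt0 : 0 < lambda) d
    (s := soft_shrinkage lambda_gt0 d) :
  (lambda%:E * norm1 s = (inner (d - s) s)%:E)%E.
Proof.
rewrite /norm1 -nneseriesZl//.
rewrite [inner _ _]/(ell2_inner (d - s) s) -EFin_lim; last exact: ell2_cvg_inner.
congr (limn _); apply/funext => n; rewrite /= /series /= -sumEFin.
by apply: eq_bigr => k _; exact: (congr1 EFin (esym (soft_residualM _ lambda_gt0))).
Qed.

End soft_thresholding.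

(** * The Moore-Penrose inverse of the analysis operator *)

Section analysis_adjoint.
Context {R : realType} {H : hilbertType R} (F : frame H).
Let T : H -> ell2 R := analysis F.

Lemma adjoint_analysisE x c : inner (T x) c = inner x (adjoint T c).
Proof.
move: x; apply: (@xgetPex _ 0 [set y | forall x, inner (T x) c = inner x y]).
have [A [B [A0 B0 AB]]] := analysis_bounds F.
apply: (@riesz_representation _ _ _ (B * `|c|)).
- by rewrite mulr_ge0 // ltW.
- by move=> a x y; rewrite /T analysisD analysisZ innerDl innerZl.
- move=> x; apply: le_trans (cauchy_schwarz _ _) _.
  by rewrite mulrAC ler_wpM2r//; have /andP[] := AB x.
Qed.

(** By the lower frame bound [x |-> <x, z>] is bounded for the norm of [HT F]; the
    vector representing it there is the required preimage of [z]. *)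
Lemma frame_operator_surj z : exists y, adjoint T (T y) = z.
Proof.
have [A [B [A0 B0 AB]]] := analysis_bounds F.
have [|||y yP] := @riesz_representation R (HT F) (fun x => inner (x : H) z)
   (A^-1 * `|z|).
- by rewrite mulr_ge0 // invr_ge0 ltW.
- by move=> a x y; rewrite innerDl innerZl.
- move=> x; apply: le_trans (cauchy_schwarz _ _) _.
  rewrite mulrAC ler_wpM2r// ler_pdivlMl//.
  by have /andP[] := AB x.
exists y; apply: inner_ext => x; rewrite -adjoint_analysisE.
exact/esym/yP.
Qed.

(** The right side is by definition the inner product of [x] and
    [moore_penrose T c] in [HT F]: the Moore-Penrose inverse is the adjoint of
    [T] seen as an operator from [HT F] to [ell2 R]. *)
Lemma moore_penrose_analysisE x c :
  inner (T x) c = inner (T x) (T (moore_penrose T c)).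
Proof.
rewrite !adjoint_analysisE; congr inner.
rewrite -[RHS]/((adjoint T \o T) _) pinvK// inE.
by have [y yE] := frame_operator_surj (adjoint T c); exists y.
Qed.

Lemma moore_penrose_eq0 c : null_space (adjoint T) c <-> moore_penrose T c = 0.
Proof.
rewrite /null_space /=; split=> [c0|c0].
  apply: (@analysis_eq0 _ _ F); apply/eqP; rewrite -sqrf_eq0 -innerxx.
  by rewrite -moore_penrose_analysisE adjoint_analysisE c0 inner0r.
have T0 : T 0 = 0 by have := analysisB F 0 0; rewrite !subrr.
apply: inner_ext => x; rewrite -adjoint_analysisE moore_penrose_analysisE.
by rewrite c0 T0 !inner0r.
Qed.

End analysis_adjoint.

Theorem corollary3p4 (R : realType) (H : hilbertType R) (F : frame H)
    (H_separable : separable H) :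
  let T : H -> ell2 R := analysis F in
  let Tdag : ell2 R -> H := moore_penrose T in
  (forall Prox : ell2 R -> ell2 R, is_prox Prox ->
     is_prox (X := HT F) (Tdag \o Prox \o T)) /\
  (forall (lambda : R) (lambda_gt0 : 0 < lambda) (x : H),
     let f : H -> \bar R := fun y =>
       inf_convolution
         (fun c => lambda%:E * norm1 c)%E
         (fun c => (2^-1 * `|c| ^+ 2)%:E + indicator (null_space (adjoint T)) c)%E
         (T y) in
     argmin (X := HT F)
       (fun y : HT F => (2^-1 * `|(x : HT F) - y| ^+ 2)%:E + f y)%E
     = [set Tdag (soft_shrinkage lambda_gt0 (T x))]).
Proof.
move=> T Tdag.
have TB : forall x y : HT F, T (x - y) = T x - T y by exact (analysisB F).
have T_isom : forall x y : HT F, inner (T x) (T y) = inner x y by [].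
have TL : forall (x : HT F) c, inner (T x) c = inner x (Tdag c : HT F).
  exact: (@moore_penrose_analysisE R H F).
split=> [Prox|lambda lambda_gt0 x f].
  exact: (is_prox_compression (K := HT F) TB T_isom TL).
apply: (argmin_inf_convolution (K := HT F) TB T_isom TL
  (g := fun c => lambda%:E * norm1 c)%E).
- exact: moore_penrose_eq0.
- exact: norm1_soft_shrinkage.
- move=> c; rewrite innerBr subrKC; apply: inner_le_norm1 => k.
  exact: soft_residual_le.
Qed.
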